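(* We have $\min_{\kappa \in [0,1]} Z^\star_{\rm ICC}(\kappa\mathbf{e}) = Z^\star_{\rm ICC}(\mathbf{e})$.
   Context: Data: a compact polyhedron $\mathcal{X} \subseteq \mathbb{R}^L$; a cost vector $\boldsymbol{c}\in\mathbb{R}^L$; a matrix $\boldsymbol{A} \in \mathbb{R}^{L\times K}$, vectors $\boldsymbol{a} \in \mathbb{R}^L$, $\boldsymbol{b} \in \mathbb{R}^K$ and a scalar $b_0 \in \mathbb{R}$ such that $\boldsymbol{A}^\top \boldsymbol{x} \neq \boldsymbol{b}$ for all $\boldsymbol{x} \in \mathcal{X}$; samples $\hat{\boldsymbol{\xi}}_1,\dots,\hat{\boldsymbol{\xi}}_N \in \mathbb{R}^K$; a risk threshold $\varepsilon \in (0,1)$; a radius $\theta \ge 0$; a norm $\|\cdot\|$ on $\mathbb{R}^K$ with dual norm $\|\cdot\|_*$. Write $[N]=\{1,\dots,N\}$ and $\mathbf{e}$ for the all-ones vector. For $\boldsymbol{\kappa}\in[0,1]^N$ define $$\mathcal{C}_{\rm ICC}(\boldsymbol{\kappa}) = \left\{(\boldsymbol{x},\boldsymbol{s},t)\in\mathcal{X}\times\mathbb{R}^N_+\times\mathbb{R} \;:\; \varepsilon N t - \mathbf{e}^\top\boldsymbol{s} \ge \theta N \|\boldsymbol{b}-\boldsymbol{A}^\top\boldsymbol{x}\|_*,\; \kappa_i\big((\boldsymbol{b}-\boldsymbol{A}^\top\boldsymbol{x})^\top\hat{\boldsymbol{\xi}}_i + b_0 - \boldsymbol{a}^\top\boldsymbol{x}\big)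 \ge t - s_i \;\forall i\in[N]\right\}$$ and $Z^\star_{\rm ICC}(\boldsymbol{\kappa}) = \min\{\boldsymbol{c}^\top\boldsymbol{x} : (\boldsymbol{x},\boldsymbol{s},t)\in\mathcal{C}_{\rm ICC}(\boldsymbol{\kappa})\}$, with the convention that the optimal value of an infeasible minimization problem is $+\infty$.
   Formalization: For θ = 0 the formal theorem takes the minimum over κ ∈ (0,1] only, since the claim with κ = 0 fails there (Z*(0) can be finite while Z*(e) = +∞); for θ > 0 the full range [0,1] is kept. *)

(* Defs.v *)
From HB Require Import structures.
From mathcomp Require Import all_boot all_order all_algebra.
From mathcomp Require Import all_classical all_reals all_analysis.

Set Implicit Arguments.
Unset Strict Implicit.
Unset Printing Implicit Defensive.

Import Order.TTheory GRing.Theory Num.Theory.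
Import numFieldNormedType.Exports.
Local Open Scope classical_set_scope.
Local Open Scope ring_scope.

Definition dotv (R : realType) (n : nat) (u v : 'cV[R]_n) : R :=
  (u^T *m v) 0 0.

(* The norm is an arbitrary one, unrelated to the sup-norm that the library
   puts on matrices. *)
Definition is_norm (R : realType) (n : nat) (nu : 'cV[R]_n -> R) : Prop :=
  [/\ forall v, 0 <= nu v,
      forall v, nu v = 0 -> v = 0,
      forall (r : R) v, nu (r *: v) = `|r| * nu v &
      forall u v, nu (u + v) <= nu u + nu v].

(* When [nu] is a norm the set is nonempty and bounded (all norms on R^n are
   equivalent), so [sup] is the genuine supremum. *)
Definition dual_norm (R : realType) (n : nat) (nu : 'cV[R]_n -> R)
    (y : 'cV[R]_n) : R :=
  sup [set dotv y z | z in [set z | nu z <= 1]].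

Definition polyhedron (R : realType) (n : nat) (X : set 'cV[R]_n) : Prop :=
  exists (m : nat) (G : 'M[R]_(m, n)) (h : 'cV[R]_m),
    X = [set x | forall i, (G *m x) i 0 <= h i 0].

Definition is_min (R : realType) (S : set (\bar R)) (z : \bar R) : Prop :=
  S z /\ lbound S z.

Definition C_ICC (R : realType) (L K N : nat) (X : set 'cV[R]_L)
    (A : 'M[R]_(L, K)) (a : 'cV[R]_L) (b : 'cV[R]_K) (b0 : R)
    (xi : 'I_N -> 'cV[R]_K) (eps theta : R) (nu : 'cV[R]_K -> R)
    (kappa : 'cV[R]_N) : set ('cV[R]_L * 'cV[R]_N * R) :=
  [set p : 'cV[R]_L * 'cV[R]_N * R | let: (x, s, t) := p in
    [/\ X x,
        forall i, 0 <= s i 0,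
        eps * N%:R * t - \sum_(i < N) s i 0
          >= theta * N%:R * dual_norm nu (b - A^T *m x) &
        forall i, kappa i 0 * (dotv (b - A^T *m x) (xi i) + b0 - dotv a x)
          >= t - s i 0]].

Definition obj_ICC (R : realType) (L K N : nat) (X : set 'cV[R]_L)
    (c : 'cV[R]_L) (A : 'M[R]_(L, K)) (a : 'cV[R]_L) (b : 'cV[R]_K) (b0 : R)
    (xi : 'I_N -> 'cV[R]_K) (eps theta : R) (nu : 'cV[R]_K -> R)
    (kappa : 'cV[R]_N) : set (\bar R) :=
  [set (dotv c p.1.1)%:E | p in C_ICC X A a b b0 xi eps theta nu kappa].

(* [ereal_inf set0 = +oo]: an infeasible problem has optimal value +oo. *)
Definition Z_ICC (R : realType) (L K N : nat) (X : set 'cV[R]_L)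
    (c : 'cV[R]_L) (A : 'M[R]_(L, K)) (a : 'cV[R]_L) (b : 'cV[R]_K) (b0 : R)
    (xi : 'I_N -> 'cV[R]_K) (eps theta : R) (nu : 'cV[R]_K -> R)
    (kappa : 'cV[R]_N) : \bar R :=
  ereal_inf (obj_ICC X c A a b b0 xi eps theta nu kappa).

(* Main.v *)
Require Import Defs.
From HB Require Import structures.
From mathcomp Require Import all_boot all_order all_algebra.
From mathcomp Require Import all_classical all_reals all_analysis.
From mathcomp Require Import lra.

Set Implicit Arguments.
Unset Strict Implicit.
Unset Printing Implicit Defensive.

Import Order.TTheory GRing.Theory Num.Theory.
Import numFieldNormedType.Exports.
Local Open Scope classical_set_scope.
Local Open Scope ring_scope.

(** Dividing [s] and [t] by [k] turns a point feasible for the constant weight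
    vector [k], with [0 < k <= 1], into one feasible for the weight vector 1:
    every constraint is homogeneous in [(kappa, s, t)] except the capacity
    constraint, whose right-hand side [theta N |b - A^T x|_*] is nonnegative, so
    that scaling up by [1 / k >= 1] can only help ([C_ICC_scale]).  As [x], hence
    the objective, is unchanged, the optimal value at 1 is the smallest.

    The weight [k = 0] has to be excluded separately.  It forces [s_i >= t] for
    all [i], so the capacity constraint would give
    [eps N t >= N t + theta N |b - A^T x|_*]; when [theta > 0] the last term is
    positive because [A^T x <> b], which contradicts [eps < 1] and [t >= 0].  The
    problem is then infeasible ([C_ICC_0_empty]) and its value [+oo] beats
    nothing.  Without samples all weight vectors coincide.

    Attainment ([obj_ICC_has_min]) is the extreme value theorem on a compact set.
    The best choice of [s] given [(x, t)] is [s_i = max(0, t - kappa_i f_i(x))],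
    where [f_i(x) = (b - A^T x) . xi_i + b0 - a . x]; this removes [s].  Compactness of [X] bounds the [f_i], and then
    [eps N t >= sum s_i >= N t - const] confines [t] to a fixed segment.  The
    remaining feasible pairs [(x, t)] form a closed set because the dual norm is
    a supremum of linear functions.

    All of this needs the dual norm to be a genuine, finite and positive
    supremum, that is, the unit ball of [nu] to be bounded: [norm_coord_bound],
    the equivalence of norms in finite dimension. *)

(** * Continuity of real functions written pointwise *)

Section PointwiseContinuity.

Context (R : realType) (T : topologicalType).
Implicit Types f g : T -> R.

Lemma continuous_add f g : continuous f -> continuous g ->
  continuous (fun x => f x + g x).
Proof. by move=> fc gc x; apply: continuousD; [exact: fc | exact: gc]. Qed.

Lemma continuous_sub f g : continuous f -> continuous g ->
  continuous (fun x => f x - g x).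
Proof. by move=> fc gc x; apply: continuousB; [exact: fc | exact: gc]. Qed.

Lemma continuous_scale (r : R) f : continuous f ->
  continuous (fun x => r * f x).
Proof.
by move=> fc x; apply: continuousM; [exact: cst_continuous | exact: fc].
Qed.

Lemma continuous_abs f : continuous f -> continuous (fun x => `|f x|).
Proof. by move=> fc x; apply: cvg_norm; exact: fc. Qed.

Lemma continuous_max0 f : continuous f ->
  continuous (fun x => Num.max 0 (f x)).
Proof.
move=> fc x; apply: (@continuous_max R T (fun=> 0) f); last exact: fc.
exact: cst_continuous.
Qed.

Lemma continuous_comp_fst {U : topologicalType} f : continuous f ->
  continuous (fun p : T * U => f p.1).
Proof.
move=> fc p; apply: (@continuous_comp _ _ _ fst f); last exact: fc.
exact: cvg_fst.
Qed.

Lemma continuous_sum n (F : 'I_n -> T -> R) : (forall i, continuous (F i)) ->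
  continuous (fun x => \sum_i F i x).
Proof. by move=> Fc; apply: (continuous_big (@add_continuous R)). Qed.

End PointwiseContinuity.

(** * The scalar product *)

Lemma dotvE (R : realType) n (u v : 'cV[R]_n) :
  dotv u v = \sum_i u i 0 * v i 0.
Proof. by rewrite /dotv mxE; apply: eq_bigr => i _; rewrite mxE. Qed.

Lemma dotvBl (R : realType) n (u v w : 'cV[R]_n) :
  dotv (u - v) w = dotv u w - dotv v w.
Proof. by rewrite /dotv linearB mulmxBl !mxE. Qed.

Lemma dotvZr (R : realType) n (r : R) (u v : 'cV[R]_n) :
  dotv u (r *: v) = r * dotv u v.
Proof. by rewrite /dotv -scalemxAr mxE. Qed.

Lemma dotv0r (R : realType) n (u : 'cV[R]_n) : dotv u 0 = 0.
Proof. by rewrite /dotv mulmx0 mxE. Qed.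

Lemma dotv_trmx_mul (R : realType) m n (A : 'M[R]_(m, n)) x z :
  dotv (A^T *m x) z = dotv (A *m z) x.
Proof.
rewrite /dotv !trmx_mul trmxK -[in RHS](trmxK (_ *m A^T *m x)) [in RHS]mxE.
by rewrite !trmx_mul !trmxK mulmxA.
Qed.

Lemma dotvv_gt0 (R : realType) n (u : 'cV[R]_n) : u <> 0 -> 0 < dotv u u.
Proof.
move=> u0; rewrite lt_neqAle dotvE sumr_ge0 ?andbT; last first.
  by move=> i _; rewrite -expr2 sqr_ge0.
apply/eqP => /esym/eqP; rewrite psumr_eq0; last first.
  by move=> i _; rewrite -expr2 sqr_ge0.
move=> /allP uu; apply: u0; apply/colP => i; rewrite mxE.
have := uu i (mem_index_enum i).
by rewrite /= mulf_eq0 orbb => /eqP.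
Qed.

Lemma dotv_continuous (R : realType) n (u : 'cV[R]_n) : continuous (dotv u).
Proof.
rewrite (_ : dotv u = fun v => \sum_i u i 0 * v i 0); last first.
  by apply/funext => v; rewrite dotvE.
by apply: continuous_sum => i; exact/continuous_scale/coord_continuous.
Qed.

(** * Norms on R^n and their duals *)

Lemma mx_coord_le_norm (R : realType) m n (M : 'M[R]_(m, n)) i j :
  `|M i j| <= `|M|.
Proof.
rewrite [leRHS]/Num.norm /= mx_normrE.
exact: (@le_bigmax _ _ _ _ (fun ij : 'I_m * 'I_n => `|M ij.1 ij.2|) (i, j)).
Qed.

Lemma is_norm0 (R : realType) n (nu : 'cV[R]_n -> R) : is_norm nu -> nu 0 = 0.
Proof. by case=> _ _ nuZ _; rewrite -(scale0r 0) nuZ normr0 mul0r. Qed.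

(** Expanding a vector in the canonical basis bounds [nu] by a multiple of the sup
    norm, and the triangle inequality turns that bound into a Lipschitz one.
    Row vectors are the setting of [bounded_closed_compact], which
    [norm_coord_bound] applies. *)
Lemma norm_trmx_continuous (R : realType) n (nu : 'cV[R]_n -> R) :
  is_norm nu -> continuous (fun v : 'rV[R]_n => nu v^T).
Proof.
move=> nuN; have [nu_ge0 _ nuZ nuD] := nuN.
pose M := \sum_(i < n) nu (delta_mx i 0).
have M_ge0 : 0 <= M by apply: sumr_ge0.
have nu_le (v : 'rV[R]_n) : nu v^T <= M * `|v|.
  rewrite [v^T]matrix_sum_delta; under eq_bigr do rewrite big_ord1.
  rewrite mulr_suml.
  elim/big_ind2 : _ => [|a a' b b' ha hb|i _]; first by rewrite is_norm0.
    exact: le_trans (nuD _ _) (lerD ha hb).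
  by rewrite nuZ mulrC ler_wpM2l // mxE mx_coord_le_norm.
have nu_dist (v w : 'rV[R]_n) : `|nu v^T - nu w^T| <= M * `|v - w|.
  have nuB (x y : 'rV[R]_n) : nu x^T - nu y^T <= M * `|x - y|.
    rewrite lerBlDr -{1}(subrK y x) linearD /=.
    by apply: le_trans (nuD _ _) _; rewrite lerD2r.
  by rewrite ler_norml nuB andbT lerNl opprB distrC nuB.
have M1 : 0 < M + 1 by rewrite ltr_wpDl.
move=> v; apply/(@cvgrPdist_lt _ _ _ (nbhs v)) => e e0; near=> w.
apply: le_lt_trans (nu_dist _ _) _.
have : `|v - w| < e / (M + 1).
  near: w; apply/nbhs_ballP; exists (e / (M + 1)); first by rewrite /= divr_gt0.
  by move=> w /=; rewrite -ball_normE.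
rewrite ltr_pdivlMr // mulrC; apply: le_lt_trans.
by rewrite ler_wpM2r // lerDl.
Unshelve. all: by end_near.
Qed.

(** The nontrivial half of the equivalence of norms: by continuity [nu] attains
    its minimum on the compact sup-norm sphere; definiteness makes this minimum
    positive, and homogeneity spreads the bound to all vectors. *)
Lemma norm_coord_bound (R : realType) n (nu : 'cV[R]_n -> R) :
  is_norm nu -> exists2 m : R, 0 < m & forall (z : 'cV[R]_n) i, m * `|z i 0| <= nu z.
Proof.
move=> nuN; have [nu_ge0 nu_eq0 nuZ _] := nuN.
pose S := [set v : 'rV[R]_n | `|v| = 1].
have S_unit (v : 'rV[R]_n) : v != 0 -> S (`|v|^-1 *: v).
  move=> v0; rewrite /S/= normrZ normfV normr_id mulVf //.
  by rewrite normr_eq0.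
have [S0|S0] := pselect (S !=set0); last first.
  (* the sphere is empty only in dimension 0, where any constant works *)
  exists 1 => // z i; rewrite (_ : z = 0) ?mxE ?normr0 ?mulr0 //.
  apply/eqP; apply: contra_notT S0 => z0; exists (`|z^T|^-1 *: z^T).
  by apply: S_unit; rewrite -trmx0 (inj_eq trmx_inj).
have cS : compact S.
  apply: bounded_closed_compact.
    exists 1; split => // r r1 v /= ->; exact: ltW.
  have -> : S = (fun v : 'rV[R]_n => `|v|) @^-1` [set 1] by [].
  apply: preimage_closed; last exact: closed_eq.
  by move=> v _; exact: norm_continuous.
have [u /set_mem Su u_min] := compact_EVT_min S0 cS
  (continuous_subspaceT (norm_trmx_continuous nuN)).
exists (nu u^T).
  rewrite lt_neqAle nu_ge0 andbT eq_sym; apply/eqP => /nu_eq0 /eqP.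
  rewrite -trmx0 (inj_eq trmx_inj) => /eqP u0.
  by move: Su; rewrite /S/= u0 normr0 => /esym/eqP; rewrite oner_eq0.
move=> z i; have [->|z0] := eqVneq z 0; first by rewrite mxE normr0 mulr0.
have v0 : z^T != 0 by rewrite -trmx0 (inj_eq trmx_inj).
have := u_min _ (mem_set (S_unit _ v0)).
rewrite linearZ /= trmxK nuZ normfV normr_id ler_pdivlMl ?normr_gt0 //.
apply: le_trans; rewrite mulrC ler_wpM2r //.
by have := mx_coord_le_norm z^T 0 i; rewrite mxE.
Qed.

(** Coordinates are bounded on the unit ball of [nu], hence so is every linear
    function; this is what makes [dual_norm] more than the default value of
    [sup]. *)
Lemma dual_ball_has_sup (R : realType) n (nu : 'cV[R]_n -> R) y :
  is_norm nu -> has_sup [set dotv y z | z in [set z | nu z <= 1]].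
Proof.
move=> nuN; have [m m_gt0 m_le] := norm_coord_bound nuN.
split; first by exists (dotv y 0), 0; rewrite //= is_norm0.
exists (\sum_i `|y i 0| * m^-1) => _ [z /= z1 <-].
rewrite dotvE; apply: ler_sum => i _.
apply: le_trans (ler_norm _) _; rewrite normrM ler_wpM2l //.
by rewrite -[m^-1]mulr1 ler_pdivlMl // (le_trans (m_le _ _)).
Qed.

Lemma dotv_le_dual_norm (R : realType) n (nu : 'cV[R]_n -> R) y z :
  is_norm nu -> nu z <= 1 -> dotv y z <= dual_norm nu y.
Proof.
move=> nuN z1; apply: sup_upper_bound; first exact: dual_ball_has_sup.
by exists z.
Qed.

Lemma dual_norm_le (R : realType) n (nu : 'cV[R]_n -> R) y e :
  is_norm nu -> (forall z, nu z <= 1 -> dotv y z <= e) -> dual_norm nu y <= e.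
Proof.
move=> nuN ye; have [ne _] := dual_ball_has_sup y nuN.
by apply: ge_sup => // _ [z /= z1 <-]; exact: ye.
Qed.

Lemma dual_norm_ge0 (R : realType) n (nu : 'cV[R]_n -> R) y :
  is_norm nu -> 0 <= dual_norm nu y.
Proof.
by move=> nuN; rewrite -(dotv0r y) dotv_le_dual_norm // is_norm0.
Qed.

(** The normalization of [y] itself is a witness. *)
Lemma dual_norm_gt0 (R : realType) n (nu : 'cV[R]_n -> R) y :
  is_norm nu -> y <> 0 -> 0 < dual_norm nu y.
Proof.
move=> nuN y0; have [nu_ge0 nu_eq0 nuZ _] := nuN.
have nuy : 0 < nu y.
  by rewrite lt_neqAle nu_ge0 andbT eq_sym; apply/eqP => /nu_eq0.
apply: (@lt_le_trans _ _ (dotv y ((nu y)^-1 *: y))).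
  by rewrite dotvZr mulr_gt0 ?invr_gt0 // dotvv_gt0.
apply: dotv_le_dual_norm => //.
by rewrite nuZ ger0_norm ?invr_ge0 // mulVf // gt_eqF.
Qed.

(** * How feasibility depends on the weights *)

Lemma ereal_inf_is_min (R : realType) (S : set (\bar R)) z :
  is_min S z -> ereal_inf S = z.
Proof.
case=> Sz lbz; apply/eqP; rewrite eq_le; apply/andP; split.
  exact: ereal_inf_lbound.
exact: le_ereal_inf_tmp.
Qed.

(** Only the right-hand side of the capacity constraint fails to scale with
    [(kappa, s, t)]; being nonnegative, it is at most [r] times itself. *)
Lemma C_ICC_scale (R : realType) (L K N : nat) (X : set 'cV[R]_L)
    (A : 'M[R]_(L, K)) (a : 'cV[R]_L) (b : 'cV[R]_K) (b0 : R)
    (xi : 'I_N -> 'cV[R]_K) (eps theta : R) (nu : 'cV[R]_K -> R)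
    (kappa : 'cV[R]_N) (r : R) x s t :
  is_norm nu -> 0 <= theta -> 1 <= r ->
  C_ICC X A a b b0 xi eps theta nu kappa (x, s, t) ->
  C_ICC X A a b b0 xi eps theta nu (r *: kappa) (x, r *: s, r * t).
Proof.
move=> nuN th r1 [Xx s0 cap marg]; have r0 : 0 <= r by apply: le_trans r1.
split => // [i||i]; first by rewrite mxE mulr_ge0.
- under eq_bigr do rewrite mxE; rewrite -mulr_sumr mulrCA -mulrBr.
  apply: le_trans (ler_wpM2l r0 cap); rewrite ler_peMl // mulr_ge0 ?mulr_ge0 //.
  exact: dual_norm_ge0.
- by rewrite !mxE -mulrA -mulrBr ler_wpM2l.
Qed.

(** Zero weights force [t <= s_i] for all samples, so the total of [s] is at
    least [N t], whereas the capacity constraint asks it to be strictly below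
    [eps N t]. *)
Lemma C_ICC_0_empty (R : realType) (L K N : nat) (X : set 'cV[R]_L)
    (A : 'M[R]_(L, K)) (a : 'cV[R]_L) (b : 'cV[R]_K) (b0 : R)
    (xi : 'I_N -> 'cV[R]_K) (eps theta : R) (nu : 'cV[R]_K -> R) :
  is_norm nu -> (forall x, X x -> A^T *m x <> b) ->
  0 < eps -> eps < 1 -> 0 < theta -> (0 < N)%N ->
  C_ICC X A a b b0 xi eps theta nu 0 = set0.
Proof.
move=> nuN b_neq e0 e1 th N0; rewrite -subset0 => -[[x s] t] [Xx s0 cap marg].
have NR : 0 < N%:R :> R by rewrite ltr0n.
have d0 : 0 < theta * N%:R * dual_norm nu (b - A^T *m x).
  rewrite mulr_gt0 ?mulr_gt0 // dual_norm_gt0 // => /eqP; rewrite subr_eq0.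
  by move=> /eqP /esym; exact: b_neq.
have st : N%:R * t <= \sum_i s i 0.
  rewrite mulrC mulr_natr -[in leLHS](card_ord N) -sumr_const ler_sum // => i _.
  by have := marg i; rewrite mxE mul0r subr_le0.
have ss : 0 <= \sum_i s i 0 by exact: sumr_ge0.
have Nt0 : 0 < N%:R * t.
  by rewrite -(pmulr_rgt0 _ e0) mulrA; lra.
have : eps * (N%:R * t) < N%:R * t by rewrite gtr_pMl.
by rewrite mulrA; lra.
Qed.

(** * Attainment of the minimum *)

Section Attainment.

Context (R : realType) (L K N : nat) (X : set 'cV[R]_L) (c : 'cV[R]_L).
Context (A : 'M[R]_(L, K)) (a : 'cV[R]_L) (b : 'cV[R]_K) (b0 : R).
Context (xi : 'I_N -> 'cV[R]_K) (eps theta : R) (nu : 'cV[R]_K -> R).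
Context (kappa : 'cV[R]_N).

Let margin i x : R := dotv (b - A^T *m x) (xi i) + b0 - dotv a x.

(** For fixed [(x, t)] the constraints on [s_i] are two lower bounds. *)
Let slack i (p : 'cV[R]_L * R) : R :=
  Num.max 0 (p.2 - kappa i 0 * margin i p.1).

(** The left-hand side of the capacity constraint once [s] takes its least
    admissible value, which maximizes it. *)
Let capacity (p : 'cV[R]_L * R) : R := eps * N%:R * p.2 - \sum_i slack i p.

Lemma C_ICC_slack x s t :
  C_ICC X A a b b0 xi eps theta nu kappa (x, s, t) ->
  X x /\ theta * N%:R * dual_norm nu (b - A^T *m x) <= capacity (x, t).
Proof.
case=> Xx s0 cap marg; split => //; apply: le_trans cap _.
rewrite lerD2l lerN2 ler_sum // => i _.
by rewrite /slack ge_max s0 /= lerBlDr addrC -lerBlDr; exact: marg.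
Qed.

Lemma slack_C_ICC x t :
  X x -> theta * N%:R * dual_norm nu (b - A^T *m x) <= capacity (x, t) ->
  C_ICC X A a b b0 xi eps theta nu kappa (x, \col_i slack i (x, t), t).
Proof.
move=> Xx cap; split => // [i||i]; first by rewrite mxE le_max lexx.
  by under eq_bigr do rewrite mxE.
by rewrite mxE lerBlDr addrC -lerBlDr le_max lexx orbT.
Qed.

Lemma residual_dotv_continuous z :
  continuous (fun x : 'cV[R]_L => dotv (b - A^T *m x) z).
Proof.
rewrite (_ : (fun _ => _) = fun x => dotv b z - dotv (A *m z) x).
  apply: continuous_sub; [exact: cst_continuous | exact: dotv_continuous].
by apply/funext => x; rewrite dotvBl dotv_trmx_mul.
Qed.

Lemma margin_continuous i : continuous (margin i).
Proof.
apply: continuous_sub; last exact: dotv_continuous.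
apply: continuous_add; last exact: cst_continuous.
exact: residual_dotv_continuous.
Qed.

Lemma capacity_continuous : continuous capacity.
Proof.
apply: continuous_sub; first by apply: continuous_scale => p; exact: cvg_snd.
apply: continuous_sum => i; apply: continuous_max0.
apply: continuous_sub => [p|]; first exact: cvg_snd.
apply: continuous_scale.
exact: (continuous_comp_fst (@margin_continuous i)).
Qed.

(** With [B] a bound on [sum_i |kappa_i f_i|] over the compact [X],
    where [f_i] is [margin i], the capacity constraint gives
    [eps N t >= sum_i s_i >= N t - B], that is [(1 - eps) N t <= B].  At
    least one sample is required: with none, [t] is unconstrained. *)
Lemma feasible_level_bound : compact X -> eps < 1 -> 0 < eps ->
  exists2 T : R, 0 <= T & forall x t, X x -> 0 <= capacity (x, t) -> (0 < N)%N ->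
    0 <= t <= T.
Proof.
move=> cX e1 e0; pose f x := \sum_i `|kappa i 0 * margin i x|.
have f_c : continuous f.
  apply: continuous_sum => i.
  exact/continuous_abs/continuous_scale/margin_continuous.
have f_ge0 x : 0 <= f x by apply: sumr_ge0.
have [B B0 fB] : exists2 B, 0 <= B & forall x, X x -> f x <= B.
  have [X0|X0] := pselect (X !=set0); last first.
    by exists 0 => // x Xx; case: X0; exists x.
  have [u _ u_max] := compact_EVT_max X0 cX (continuous_subspaceT f_c).
  by exists (f u) => // x Xx; exact/u_max/mem_set.
have e1' : 0 < 1 - eps by rewrite subr_gt0.
exists (B / (1 - eps)); first by rewrite divr_ge0 // ltW.
move=> x t Xx cap N0.
have NR : 1 <= N%:R :> R by rewrite ler1n.
have slack0 i : 0 <= slack i (x, t) by rewrite le_max lexx.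
have S0 : 0 <= \sum_i slack i (x, t) by apply: sumr_ge0.
have t0 : 0 <= t.
  rewrite -(pmulr_rge0 _ (mulr_gt0 e0 (lt_le_trans ltr01 NR))).
  by apply: le_trans S0 _; rewrite -subr_ge0.
rewrite t0 /= ler_pdivlMr //.
have : N%:R * t - f x <= \sum_i slack i (x, t).
  rewrite mulrC mulr_natr -[X in t *+ X](card_ord N) -sumr_const -sumrB.
  apply: ler_sum => i _; rewrite le_max; apply/orP; right.
  by rewrite lerD2l lerN2 ler_norm.
have := fB x Xx; move: cap; rewrite /capacity /= => cap fxB St.
have h : (1 - eps) * (N%:R * t) <= B by rewrite mulrBl mul1r mulrA; lra.
apply: le_trans h; rewrite [leLHS]mulrC ler_wpM2l ?(ltW e1') //.
by rewrite ler_peMl.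
Qed.

(** Minimize [c . x] over the pairs [(x, t)] for which some [s] is feasible,
    with [t] restricted to the segment of [feasible_level_bound]. *)
Lemma obj_ICC_has_min : compact X -> eps < 1 -> 0 < eps -> 0 <= theta ->
  is_norm nu ->
  C_ICC X A a b b0 xi eps theta nu kappa !=set0 ->
  exists z, is_min (obj_ICC X c A a b b0 xi eps theta nu kappa) z.
Proof.
move=> cX e1 e0 th nuN [[[x1 s1] t1] C1].
have [T T0 tT] := feasible_level_bound cX e1 e0.
pose F := [set p : 'cV[R]_L * R | theta * N%:R * dual_norm nu (b - A^T *m p.1)
                                  <= capacity p].
pose S := (X `*` `[0, T]%classic) `&` F.
(* an upper bound on a supremum of continuous functions is an intersection of
   closed conditions, one per vector of the unit ball *)
have FE : F = \bigcap_(z in [set z | nu z <= 1])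
    [set p | 0 <= capacity p - theta * N%:R * dotv (b - A^T *m p.1) z].
  apply/seteqP; split => p /= Fp.
    move=> z z1; rewrite /= subr_ge0; apply: le_trans Fp.
    by rewrite ler_wpM2l ?mulr_ge0 // dotv_le_dual_norm.
  (* a zero coefficient hides the supremum; the vector 0 alone then suffices *)
  have [k0|k0] := eqVneq (theta * N%:R) 0.
    have := Fp 0; rewrite /= is_norm0 // => /(_ ler01).
    by rewrite /F/= k0 !mul0r subr0.
  have kp : 0 < theta * N%:R by rewrite lt_neqAle eq_sym k0 mulr_ge0.
  rewrite /F/= -ler_pdivlMl //; apply: dual_norm_le => // z z1.
  by rewrite ler_pdivlMl // -subr_ge0; exact: Fp.
have clF : closed F.
  rewrite FE; apply: closed_bigI => z _.
  apply: (@preimage_closed _ _ _ [set r : R | 0 <= r]); last exact: closed_ge.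
  move=> p _; apply: continuous_sub; first exact: capacity_continuous.
  apply: continuous_scale.
  exact: (continuous_comp_fst (@residual_dotv_continuous z)).
have cS : compact S.
  apply: compact_closedI => //; apply: compact_setX => //.
  exact: segment_compact.
(* without samples t does not matter, and 0 is taken instead of it *)
have inS x s t : C_ICC X A a b b0 xi eps theta nu kappa (x, s, t) ->
    exists t', S (x, t').
  move=> /C_ICC_slack [Xx cap].
  have [N0|N0] := posnP N.
    exists 0; split; first by split => //=; rewrite in_itv /= lexx.
    rewrite /F /capacity /= (_ : N%:R = 0) ?N0 // !mulr0 !mul0r.
    by rewrite big1 ?subr0 // => -[k kN]; exfalso; move: kN; rewrite N0.
  exists t; split => //; split => //=; rewrite in_itv /=.
  apply: tT => //; first exact: Xx.
  by apply: le_trans cap; rewrite !mulr_ge0 // dual_norm_ge0.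
have S0 : S !=set0 by have [t' St'] := inS _ _ _ C1; exists (x1, t').
have obj_c : continuous (fun p : 'cV[R]_L * R => dotv c p.1).
  exact: (continuous_comp_fst (@dotv_continuous _ _ c)).
have [[x t] /set_mem [[/= Xx _] Fx] x_min] :=
  compact_EVT_min S0 cS (continuous_subspaceT obj_c).
exists (dotv c x)%:E; split.
  by exists (x, \col_i slack i (x, t), t) => //; exact: slack_C_ICC.
move=> _ [[[x' s'] t'] C' <-]; rewrite lee_fin /=.
have [t2 S2] := inS _ _ _ C'.
exact: (x_min _ (mem_set S2)).
Qed.

End Attainment.

(** * Comparison of the optimal values *)

Theorem proposition5 (R : realType) (L K N : nat)
    (X : set 'cV[R]_L) (c : 'cV[R]_L)
    (A : 'M[R]_(L, K)) (a : 'cV[R]_L) (b : 'cV[R]_K) (b0 : R)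
    (xi : 'I_N -> 'cV[R]_K) (eps theta : R) (nu : 'cV[R]_K -> R)
    (X_polyhedron : polyhedron X) (X_compact : compact X)
    (b_neq : forall x, X x -> A^T *m x <> b)
    (eps_gt0 : 0 < eps) (eps_lt1 : eps < 1) (theta_ge0 : 0 <= theta)
    (nu_norm : is_norm nu) :
  let C := C_ICC X A a b b0 xi eps theta nu in
  let obj := obj_ICC X c A a b b0 xi eps theta nu in
  let Z := Z_ICC X c A a b b0 xi eps theta nu in
  [/\ forall kappa : 'cV[R]_N, (forall i, 0 <= kappa i 0 <= 1) ->
        C kappa !=set0 -> is_min (obj kappa) (Z kappa),
      0 < theta ->
        is_min [set Z (const_mx k) | k in [set k : R | 0 <= k <= 1]]
               (Z (const_mx 1)) &
      theta = 0 ->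
        is_min [set Z (const_mx k) | k in [set k : R | 0 < k <= 1]]
               (Z (const_mx 1))].
Proof.
move=> C obj Z.
have scale k r : 1 <= r -> obj k `<=` obj (r *: k).
  move=> r1 _ [[[x s] t] Ck <-]; exists (x, r *: s, r * t) => //.
  exact: C_ICC_scale.
have Z_mono (k : R) : 0 < k <= 1 -> (Z (const_mx 1%R) <= Z (const_mx k))%E.
  move=> /andP[k0 k1]; have -> : const_mx 1 = k^-1 *: const_mx k :> 'cV[R]_N.
    by apply/colP => i; rewrite !mxE mulVf // gt_eqF.
  by apply/ereal_inf_le_tmp/scale; rewrite invf_ge1.
split.
- move=> kappa _ Ck.
  have [z zmin] := obj_ICC_has_min c X_compact eps_lt1 eps_gt0 theta_ge0
    nu_norm Ck.
  by rewrite /Z /Z_ICC (ereal_inf_is_min zmin).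
- move=> theta0; split; first by exists 1 => //=; rewrite ler01 lexx.
  move=> _ [k /= /andP[k0 k1] <-].
  have [k_gt0|k_le0] := ltP 0 k; first by rewrite Z_mono ?k_gt0.
  have -> : k = 0 by apply/eqP; rewrite eq_le k0 k_le0.
  (* without samples there is a single weight vector, so k = 0 is no exception *)
  have [N0|N0] := posnP N.
    suff -> : const_mx 0 = const_mx 1 :> 'cV[R]_N by [].
    by apply/colP => -[i iN]; exfalso; move: iN; rewrite N0.
  rewrite [leRHS]/Z /Z_ICC /obj_ICC.
  by rewrite C_ICC_0_empty // image_set0 ereal_inf0 leey.
- move=> _; split; first by exists 1 => //=; rewrite ltr01 lexx.
  by move=> _ [k /= k01 <-]; exact: Z_mono.
Qed.
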